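(* Let $s\in(0,1)$, $\gamma\in(0,1]$, $n>2s$, let $\Omega\subset\mathbb{R}^n$ be a bounded domain, and let $\mathbb{G}$ be a Green kernel on $\Omega$ with Green operator $\mathcal{G}$, eigenvalues $\lambda_k^{-1}$, eigenfunctions $\varphi_k$ and heat semigroup $\mathcal{S}(t)$ as in the context. Assume: (1) $\mathbb{G}(x,y)=\mathbb{G}(y,x)\asymp |x-y|^{-(n-2s)}\left(\frac{\delta(x)\delta(y)}{|x-y|^2}\wedge 1\right)^{\gamma}$ for all $x\neq y$ in $\Omega$; (2) $\mathcal{G}:\delta^\gamma L^\infty(\Omega)\to\delta^\gamma C(\overline\Omega)$ is continuous; (3) for all $t\ge 0$, $0\le u_0\le 1$ implies $0\le \mathcal{S}(t)[u_0]\le 1$. Then there exists $c>0$, depending only on $n$, $s$, $|\Omega|$ and the Sobolev constant $C_S$ of $\mathrm{L}$ on $\Omega$, such that $$\lambda_k\ge c\,k^{2s/n}\qquad\text{for all }k\in\mathbb{N},\ k\ge1.$$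
   Context: Notation: $\delta(x)=\mathrm{dist}(x,\Omega^c)$; $a\wedge b=\min(a,b)$; $\asymp$ means two-sided bounds by positive constants independent of $x,y$; $\delta^\gamma X=\{\delta^\gamma v:v\in X\}$ with norm $\|u\|_{\delta^\gamma X}=\|u/\delta^\gamma\|_X$. $\mathbb{G}:\Omega\times\Omega\to[0,\infty]$ is a measurable kernel and $\mathcal{G}[f](x)=\int_\Omega\mathbb{G}(x,y)f(y)\,dy$ is the solution operator of $\mathrm{L}v=f$ with zero exterior/boundary data, i.e. $\mathrm{L}$ is the inverse of $\mathcal{G}$. Standing eigen-decomposition: $\mathcal{G}$ is a compact, self-adjoint, injective, positive operator on $L^2(\Omega)$, and there is an orthonormal basis $(\varphi_k)_{k\ge1}$ of $L^2(\Omega)$ with $\mathcal{G}[\varphi_k]=\lambda_k^{-1}\varphi_k$, $0<\lambda_1<\lambda_2\le\lambda_3\le\cdots\to\infty$. The heat semigroup is $\mathcal{S}(t)[u_0]=\sum_{k\ge1}e^{-\lambda_kt}\langle u_0,\varphi_k\rangle\varphi_k$, with $\langle\cdot,\cdot\rangle$ the $L^2(\Omega)$ inner product. Sobolev constant: under assumption (1) it is known that there is $C_S>0$ such that, with $\alpha=\frac{2n}{n-2s}$, $C_S\|u\|_{L^{\alpha}(\Omega)}\le\left(\sum_{k\ge1}\lambda_k\langle u,\varphi_k\rangle^2\right)^{1/2}$ for all $u\in H^1_{\mathrm{L}}(\Omega)=\{u\in L^2(\Omega):\sum_k\lambda_k\langle u,\varphi_k\rangle^2<\infty\}$; $C_S$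 is called the Sobolev constant of $\mathrm{L}$ on $\Omega$. *)

(* Defs.v *)
From HB Require Import structures.
From mathcomp Require Import all_boot all_order all_algebra.
From mathcomp Require Import all_classical all_reals all_analysis.
From mathcomp Require Import measurable_realfun.

Set Implicit Arguments.
Unset Strict Implicit.
Unset Printing Implicit Defensive.

Import Order.TTheory GRing.Theory Num.Theory.
Import numFieldNormedType.Exports.

Local Open Scope classical_set_scope.
Local Open Scope ring_scope.

(* 'rV[T]_n carries the product sigma-algebra, which for T = R contains the open
   sets of R^n (measurable_row_open) and hence is its Borel sigma-algebra. *)
Definition measure_row_display : measure_display -> measure_display.
Proof. exact. Qed.

Section measurable_row.
Context {d} {T : sigmaRingType d}.
Variable n : nat.

Let coors : 'I_n -> 'rV[T]_n -> T := fun i x => x ord0 i.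

Let row_set0 : g_sigma_preimage coors set0.
Proof. exact: sigma_algebra0. Qed.

Let row_setC A : g_sigma_preimage coors A -> g_sigma_preimage coors (~` A).
Proof. exact: sigma_algebraC. Qed.

Let row_bigcup (F : _^nat) : (forall i, g_sigma_preimage coors (F i)) ->
  g_sigma_preimage coors (\bigcup_i (F i)).
Proof. exact: sigma_algebra_bigcup. Qed.

HB.instance Definition _ := @isMeasurable.Build (measure_row_display d)
  'rV[T]_n (g_sigma_preimage coors) row_set0 row_setC row_bigcup.

End measurable_row.


Section cons_row.
Context {d} {T : measurableType d}.

Lemma measurable_row_coord n (i : 'I_n) :
  measurable_fun [set: 'rV[T]_n] (fun x => x ord0 i).
Proof.
move=> _ Y mY; rewrite setTI; apply: sub_sigma_algebra => /=.
rewrite -bigcup_seq/=; exists i => /=; first by rewrite mem_index_enum.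
by exists Y => //; rewrite setTI.
Qed.

Lemma measurable_rowP d1 (T1 : measurableType d1) n (f : T1 -> 'rV[T]_n) :
  (forall i, measurable_fun [set: T1] (fun x => f x ord0 i)) ->
  measurable_fun [set: T1] f.
Proof.
move=> mf.
apply: (@measurability _ _ _ _ _ _ (\big[setU/set0]_(i < n)
  preimage_set_system setT (fun x : 'rV[T]_n => x ord0 i) measurable)) => //.
move=> _ [A + <-]; rewrite -bigcup_seq/= => -[i _ [B mB <-]].
by rewrite !setTI -[X in measurable X]setTI; exact: mf.
Qed.

Lemma measurable_row_box n (A : 'I_n -> set T) :
  (forall i, measurable (A i)) ->
  measurable [set x : 'rV[T]_n | forall i, A i (x ord0 i)].
Proof.
move=> mA; pose F i := (fun x : 'rV[T]_n => x ord0 i) @^-1` A i.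
rewrite (_ : mkset _ = \bigcap_i F i); last first.
  by apply/seteqP; split=> x /= Ax i; [move=> _|]; exact: Ax.
apply: fin_bigcap_measurable => // i _.
by rewrite -[X in measurable X]setTI; exact: measurable_row_coord.
Qed.

Definition cons_row n (z : T * 'rV[T]_n) : 'rV[T]_n.+1 :=
  \row_(i < n.+1) oapp (z.2 ord0) z.1 (unlift ord0 i).

Lemma measurable_cons_row n : measurable_fun [set: T * 'rV[T]_n] (@cons_row n).
Proof.
apply: measurable_rowP => i; rewrite /cons_row.
under eq_fun do rewrite mxE.
case: unliftP => [j _|_] /=; last exact: measurable_fst.
exact: (measurableT_comp (measurable_row_coord j) measurable_snd).
Qed.

Definition uncons_row n (x : 'rV[T]_n.+1) : T * 'rV[T]_n :=
  (x ord0 ord0, \row_(j < n) x ord0 (lift ord0 j)).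

Lemma cons_rowK n : cancel (@cons_row n) (@uncons_row n).
Proof.
move=> [a v]; congr pair; first by rewrite mxE unlift_none.
by apply/rowP => j; rewrite !mxE liftK.
Qed.

Lemma measurable_uncons_row n :
  measurable_fun [set: 'rV[T]_n.+1] (@uncons_row n).
Proof.
apply: measurable_fun_pair; first exact: measurable_row_coord.
apply: measurable_rowP => j; under eq_fun do rewrite mxE.
exact: measurable_row_coord.
Qed.

End cons_row.

Section lebesgue_row.
Context {R : realType}.
Local Open Scope ereal_scope.

Section step.
Variables (n : nat) (m : {sigma_finite_measure set 'rV[R]_n -> \bar R}).

Definition lebesgue_row_step : set 'rV[R]_n.+1 -> \bar R :=
  pushforward (lebesgue_measure \x m) (@cons_row _ R n).

Let step0 : lebesgue_row_step set0 = 0.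
Proof. by rewrite /lebesgue_row_step /pushforward preimage_set0 measure0. Qed.

Let step_ge0 A : 0 <= lebesgue_row_step A.
Proof. by rewrite /lebesgue_row_step /pushforward measure_ge0. Qed.

Let step_sigma_additive : semi_sigma_additive lebesgue_row_step.
Proof.
move=> F mF tF mUF; rewrite /lebesgue_row_step /pushforward preimage_bigcup.
have mc A : measurable A -> measurable (@cons_row _ R n @^-1` A).
  by move=> mA; rewrite -[X in measurable X]setTI; exact: measurable_cons_row.
apply: measure_semi_sigma_additive => [k||]; first exact: mc.
- apply/trivIsetP => i j _ _ ij; rewrite -preimage_setI.
  by move/trivIsetP : tF => /(_ _ _ _ _ ij) ->//; rewrite preimage_set0.
- by rewrite -preimage_bigcup; exact: mc.
Qed.

HB.instance Definition _ := isMeasure.Build _ _ _ lebesgue_row_step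
  step0 step_ge0 step_sigma_additive.

Let step_sigma_finite : sigma_finite setT lebesgue_row_step.
Proof.
have /sigma_finiteP[F [FT ndF Foo]] := sigma_finiteT (@lebesgue_measure R).
have /sigma_finiteP[G [GT ndG Goo]] := sigma_finiteT m.
exists (fun i => @uncons_row _ R n @^-1` (F i `*` G i)).
  rewrite -preimage_bigcup -[LHS](preimage_setT (@uncons_row _ R n)).
  congr (_ @^-1` _); rewrite -setXTT FT GT; apply/seteqP; split => -[x y] /=.
    move=> [[i _ Fix] [j _ Gjy]]; exists (maxn i j) => //; split.
      by move: x Fix; exact/subsetPset/ndF/leq_maxl.
    by move: y Gjy; exact/subsetPset/ndG/leq_maxr.
  by move=> [i _ [? ?]]; split; exists i.
move=> i; have [[mF Fi] [mG Gi]] := (Foo i, Goo i); split.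
  rewrite -[X in measurable X]setTI; apply: measurable_uncons_row => //.
  exact: measurableX.
rewrite /lebesgue_row_step /pushforward -comp_preimage.
rewrite (_ : _ \o _ = id); last by apply/funext => z; exact: cons_rowK.
by rewrite preimage_id product_measure1E// lte_mul_pinfty// ge0_fin_numE.
Qed.

HB.instance Definition _ := Measure_isSigmaFinite.Build _ _ _ lebesgue_row_step
  step_sigma_finite.

End step.

Fixpoint lebesgue_row n : {sigma_finite_measure set 'rV[R]_n -> \bar R} :=
  match n with
  | 0 => \d_(0%R : 'rV[R]_0)
  | p.+1 => lebesgue_row_step (lebesgue_row p)
  end.

Lemma lebesgue_row_box n (A : 'I_n -> set R) :
  (forall i, measurable (A i)) ->
  lebesgue_row n [set x | forall i, A i (x ord0 i)] =
  \prod_(i < n) lebesgue_measure (A i).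
Proof.
elim: n A => [|n IHn] A mA.
  by rewrite big_ord0 /= diracE mem_set// => -[].
rewrite big_ord_recl -(IHn (fun i => A (lift ord0 i)))//.
pose B : set 'rV[R]_n := [set x | forall i, A (lift ord0 i) (x ord0 i)].
have mB : measurable B.
  exact: (measurable_row_box (A := fun i => A (lift ord0 i))).
apply: (eq_trans _ (product_measure1E lebesgue_measure (lebesgue_row n)
  (mA ord0) mB)).
rewrite /= /lebesgue_row_step /pushforward; congr ((_ \x _) _).
apply/seteqP; split => -[a v] /=.
  move=> Av; split; first by have := Av ord0; rewrite mxE unlift_none.
  by move=> i; have := Av (lift ord0 i); rewrite mxE liftK.
move=> [Aa Av] i; rewrite mxE.
by case: unliftP => [j ->|->]//=.
Qed.


Lemma measurable_row_open n (U : set 'rV[R]_n) : open U -> measurable U.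
Proof.
move=> oU.
pose B (q : 'rV[rat]_n * nat) : set 'rV[R]_n :=
  [set x | forall i, ball (ratr (q.1 ord0 i) : R) q.2.+1%:R^-1%R (x ord0 i)].
rewrite (_ : U = \bigcup_(q in [set q | B q `<=` U]) B q); last first.
  apply/seteqP; split=> [x Ux|x [q /= + Bq]]; last exact.
  have /nbhs_ballP[e /= e0 eU] : nbhs x U by exact: open_nbhs_nbhs.
  have [k ke] : exists k, (k.+1%:R^-1 < e / 2)%R.
    have e20 : (0 < e / 2)%R by rewrite divr_gt0.
    have [k _ /(_ k (leqnn k))] := near_infty_natSinv_lt (PosNum e20).
    by exists k.
  have qP i : exists q : rat, ball (ratr q : R) k.+1%:R^-1%R (x ord0 i).
    have : (x ord0 i - k.+1%:R^-1 < x ord0 i + k.+1%:R^-1)%R.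
      by rewrite ltrD2l gtrN.
    move=> /rat_in_itvoo[q]; rewrite in_itv/= => /andP[q1 q2]; exists q.
    by rewrite -ball_normE /ball_ /= ltr_distl q1 q2.
  pose q := \row_i projT1 (cid (qP i)).
  exists (q, k); last by move=> i /=; rewrite mxE; case: cid.
  move=> y By; apply: eU; split=> // i j; rewrite ord1 [e]splitr.
  have := By j; rewrite /= mxE; case: cid => r /= xr yr.
  apply: (ball_triangle (y := ratr r : R)).
    by apply: (le_ball (ltW ke)); exact: ball_sym.
  exact: (le_ball (ltW ke)).
rewrite bigcup_mkcond; apply: countable_bigcupT_measurable => //.
move=> q; case: ifPn => // _.
apply: (measurable_row_box
  (A := fun i => ball (ratr (q.1 ord0 i) : R) q.2.+1%:R^-1%R)) => i.
by apply: open_measurable; exact: ball_open.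
Qed.

End lebesgue_row.

(* `|x| on 'rV[R]_n is the sup norm, hence the separate Euclidean norm. *)
Definition enorm {R : realType} {n : nat} (x : 'rV[R]_n) : R :=
  Num.sqrt (\sum_(i < n) x ord0 i ^+ 2).

Section domain.
Context {R : realType} {n : nat}.
Implicit Types (Omega : set 'rV[R]_n) (u v w f : 'rV[R]_n -> R) (p : \bar R).
Local Notation mu := (@lebesgue_row R n).

Definition bounded_domain Omega :=
  [/\ Omega !=set0, open Omega, connected Omega & bounded_set Omega].

Definition dist_compl Omega (x : 'rV[R]_n) : R :=
  inf [set enorm (x - y) | y in ~` Omega].

(* L^p(Omega) is realized inside the library's L^p(R^n) through extension by
   zero outside Omega. Its elements are functions, not classes: equality in
   L^p(Omega) is [ae_eq_on Omega]. *)
Definition Lp Omega p : set ('rV[R]_n -> R) :=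
  [set u | u \_ Omega \in Lfun mu p].

Definition Lp_norm Omega p u : \bar R := ('N[mu]_p [EFin \o (u \_ Omega)])%E.

Definition ae_eq_on Omega u v := {ae mu, forall x, Omega x -> u x = v x}.

Definition inner Omega u v : R := \int[mu]_(x in Omega) (u x * v x).

Definition L2_cvg Omega (f : nat -> 'rV[R]_n -> R) u :=
  Lp_norm Omega 2%:E (f N \- u) @[N --> \oo] --> 0%E.

Definition weighted_Linf Omega (gamma : R) : set ('rV[R]_n -> R) :=
  [set f | Lp Omega +oo%E (fun x => f x / dist_compl Omega x `^ gamma)].

Definition weighted_Linf_norm Omega (gamma : R) f : \bar R :=
  Lp_norm Omega +oo%E (fun x => f x / dist_compl Omega x `^ gamma).

(* v = delta^gamma w on Omega with w in C(closure Omega); w is determined by v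
   since Omega is dense in its closure, and it represents v / delta^gamma *)
Definition weighted_C Omega (gamma : R) v w :=
  {within closure Omega, continuous w} /\
  (forall x, Omega x -> v x = dist_compl Omega x `^ gamma * w x).

Definition C_norm Omega w : R := sup [set `|w x| | x in closure Omega].

Definition continuous_weighted Omega (gamma : R)
    (T : ('rV[R]_n -> R) -> 'rV[R]_n -> R) :=
  (forall f, weighted_Linf Omega gamma f ->
     exists w, weighted_C Omega gamma (T f) w) /\
  (forall f0 w0, weighted_Linf Omega gamma f0 ->
     weighted_C Omega gamma (T f0) w0 ->
   forall e : R, 0 < e -> exists2 d : R, 0 < d &
   forall f w, weighted_Linf Omega gamma f -> weighted_C Omega gamma (T f) w ->
     (weighted_Linf_norm Omega gamma (f \- f0)%R < d%:E)%E ->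
     C_norm Omega (w \- w0) < e).

Definition compact_operator Omega (T : ('rV[R]_n -> R) -> 'rV[R]_n -> R) :=
  forall f : nat -> 'rV[R]_n -> R,
    (forall j, Lp Omega 2%:E (f j)) ->
    (exists M : R, forall j, (Lp_norm Omega 2%:E (f j) <= M%:E)%E) ->
  exists (sigma : nat -> nat) (g : 'rV[R]_n -> R),
    [/\ {homo sigma : i j / (i < j)%N}, Lp Omega 2%:E g &
        L2_cvg Omega (fun j => T (f (sigma j))) g].

Definition self_adjoint Omega (T : ('rV[R]_n -> R) -> 'rV[R]_n -> R) :=
  forall f g, Lp Omega 2%:E f -> Lp Omega 2%:E g ->
  inner Omega (T f) g = inner Omega f (T g).

Definition injective_operator Omega (T : ('rV[R]_n -> R) -> 'rV[R]_n -> R) :=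
  forall f g, Lp Omega 2%:E f -> Lp Omega 2%:E g ->
  ae_eq_on Omega (T f) (T g) -> ae_eq_on Omega f g.

(* Positivity in the sense of quadratic forms. *)
Definition positive_operator Omega (T : ('rV[R]_n -> R) -> 'rV[R]_n -> R) :=
  forall f, Lp Omega 2%:E f -> 0 <= inner Omega (T f) f.

Definition green_kernel Omega (G : 'rV[R]_n -> 'rV[R]_n -> \bar R) :=
  measurable_fun (Omega `*` Omega) (fun z : 'rV[R]_n * 'rV[R]_n => G z.1 z.2) /\
  (forall x y, Omega x -> Omega y -> (0 <= G x y)%E).

Definition green_op Omega (G : 'rV[R]_n -> 'rV[R]_n -> \bar R) f
    (x : 'rV[R]_n) : R :=
  fine (\int[mu]_(y in Omega) (G x y * (f y)%:E)).

(* The integrability clause makes sure that [fine] in [green_op] never returns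
   a default value, up to null sets. *)
Definition L2_operator Omega (G : 'rV[R]_n -> 'rV[R]_n -> \bar R) :=
  forall f, Lp Omega 2%:E f ->
    {ae mu, forall x, Omega x ->
      mu.-integrable Omega (fun y => (G x y * (f y)%:E)%E)} /\
    Lp Omega 2%:E (green_op Omega G f).

Definition green_profile Omega (s gamma : R) (x y : 'rV[R]_n) : R :=
  enorm (x - y) `^ (- (n%:R - 2 * s)) *
  (Num.min (dist_compl Omega x * dist_compl Omega y / enorm (x - y) ^+ 2) 1)
    `^ gamma.

Definition green_bounds Omega (s gamma : R)
    (G : 'rV[R]_n -> 'rV[R]_n -> \bar R) :=
  exists c0 c1 : R, [/\ 0 < c0, 0 < c1 &
  forall x y, Omega x -> Omega y -> x != y ->
    G x y = G y x /\
    ((c0 * green_profile Omega s gamma x y)%:E <= G x y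
       <= (c1 * green_profile Omega s gamma x y)%:E)%E].

(* As in the decomposition (phi_k)_{k >= 1}, sequences start at index 1; their
   values at 0 are never used. *)
Definition fourier_sum Omega (phi : nat -> 'rV[R]_n -> R) (a : nat -> R) u
    (N : nat) : 'rV[R]_n -> R :=
  fun x => \sum_(1 <= k < N.+1) a k * inner Omega u (phi k) * phi k x.

Definition orthonormal_basis Omega (phi : nat -> 'rV[R]_n -> R) :=
  [/\ forall k, (1 <= k)%N -> Lp Omega 2%:E (phi k),
      forall j k, (1 <= j)%N -> (1 <= k)%N ->
        inner Omega (phi j) (phi k) = (j == k)%:R &
      forall u, Lp Omega 2%:E u ->
        L2_cvg Omega (fourier_sum Omega phi (fun=> 1) u) u].

Definition eigen_decomposition Omega (G : 'rV[R]_n -> 'rV[R]_n -> \bar R)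
    (lam : nat -> R) (phi : nat -> 'rV[R]_n -> R) :=
  [/\ orthonormal_basis Omega phi,
      forall k, (1 <= k)%N ->
        ae_eq_on Omega (green_op Omega G (phi k))
          (fun x => (lam k)^-1 * phi k x),
      0 < lam 1%N < lam 2%N,
      forall k, (2 <= k)%N -> lam k <= lam k.+1 &
      lam k @[k --> \oo] --> +oo].

Definition green_setting Omega (G : 'rV[R]_n -> 'rV[R]_n -> \bar R)
    (lam : nat -> R) (phi : nat -> 'rV[R]_n -> R) :=
  [/\ green_kernel Omega G,
      L2_operator Omega G,
      compact_operator Omega (green_op Omega G) /\
        self_adjoint Omega (green_op Omega G),
      injective_operator Omega (green_op Omega G) /\
        positive_operator Omega (green_op Omega G) &
      eigen_decomposition Omega G lam phi].

(* v is a representative of S(t)[u] *)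
Definition heat_semigroup Omega (lam : nat -> R) (phi : nat -> 'rV[R]_n -> R)
    (t : R) u v :=
  Lp Omega 2%:E v /\
  L2_cvg Omega (fourier_sum Omega phi (fun k => expR (- lam k * t)) u) v.

Definition sub_markovian Omega (lam : nat -> R) (phi : nat -> 'rV[R]_n -> R) :=
  forall (t : R) u v, 0 <= t -> Lp Omega 2%:E u ->
    heat_semigroup Omega lam phi t u v ->
    {ae mu, forall x, Omega x -> 0 <= u x <= 1} ->
    {ae mu, forall x, Omega x -> 0 <= v x <= 1}.

Definition energy Omega (lam : nat -> R) (phi : nat -> 'rV[R]_n -> R) u
    : \bar R :=
  (\sum_(1 <= k <oo) (lam k * inner Omega u (phi k) ^+ 2)%:E)%E.

Definition sobolev_constant Omega (s : R) (lam : nat -> R)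
    (phi : nat -> 'rV[R]_n -> R) (CS : R) :=
  0 < CS /\
  forall u, Lp Omega 2%:E u -> (energy Omega lam phi u < +oo)%E ->
  (CS%:E * Lp_norm Omega (2 * n%:R / (n%:R - 2 * s))%:E u
     <= energy Omega lam phi u `^ 2^-1)%E.

End domain.

(* Main.v *)
(* On the span of the first [N] eigenfunctions we bound [sum_(k <= N) phi_k^2] pointwise.
For an indicator [f = 1_A] put [v_t = S(t)[f]].  The Markov property gives [0 <= v_t <= 1],
and with the symmetry of [S(t)] it gives [int v_t = <f, S(t)[1]> <= |A|].  Hoelder and Sobolev
yield Nash's inequality [|v|_2^(2 + 2 nu) <= |v|_1^(2 nu) E(v) / CS^2] for [nu = 2 s / n];
together with [lambda exp(-2 lambda t) <= exp(- lambda t) / t] this bounds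
[|v_t|_2^(2 + 2 nu)] by [C |v_(t/2)|_2^2 / t], whence [|v_t|_2^2 <= B |A|^2 t^(-1/nu)].
At [t = 1 / lambda_N], Bessel's inequality gives
[sum_(k <= N) <1_A, phi_k>^2 <= M |A|^2] with [M = e^2 B lambda_N^(1/nu)].
As [A] is arbitrary, [2 sum a_k phi_k - |a|^2 <= M] almost everywhere, simultaneously for all
rational vectors [a], so that [sum_(k <= N) phi_k^2 <= M] almost everywhere; integrating over
[Omega], [N <= M |Omega|]. *)
Require Import Defs.
From mathcomp Require Import all_boot all_order all_algebra.
From mathcomp Require Import all_classical all_reals all_analysis.
From mathcomp Require Import measurable_realfun ring lra.

Import Order.TTheory GRing.Theory Num.Theory.
Import numFieldNormedType.Exports.

Set Implicit Arguments.
Unset Strict Implicit.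
Unset Printing Implicit Defensive.

Local Open Scope classical_set_scope.
Local Open Scope ring_scope.

(** * The space L^2(Omega) *)

Section L2.
Context {R : realType} {n : nat}.
Variable Omega : set 'rV[R]_n.
Hypothesis mOmega : measurable Omega.
Local Notation mu := (@lebesgue_row R n).
Local Notation ip := (inner Omega).
Implicit Types u v w : 'rV[R]_n -> R.

Lemma Lp_norm_fin (p : R) u : p != 0 ->
  Lp_norm Omega p%:E u = ((\int[mu]_(x in Omega) (`|u x| `^ p)%:E) `^ p^-1)%E.
Proof.
move=> p0; rewrite /Lp_norm unlock [in RHS]integral_mkcond; congr (_ `^ _)%E.
apply: eq_integral => x _; rewrite !patchE/= !patchE; case: ifPn => //= _.
(* Outside [Omega] the integrand is a power of zero, which is zero because [p != 0]. *)
by rewrite normr0 powR0.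
Qed.

Lemma Lp2P u : Lp Omega 2%:E u <->
  measurable_fun Omega u /\ (\int[mu]_(x in Omega) (u x ^+ 2)%:E < +oo)%E.
Proof.
have E : (\int[mu]_(x in Omega) (`|u x| `^ 2)%:E = \int[mu]_(x in Omega) (u x ^+ 2)%:E)%E.
  by apply: eq_integral => x _; rewrite powR_mulrn// real_normK// num_real.
split.
  rewrite /Lp /= inE => /andP[]; rewrite !inE/= => mu_ + .
  rewrite /finite_norm -[X in (X < _)%E]/(Lp_norm Omega 2%:E u) Lp_norm_fin// E => h.
  split; first by apply/(measurable_restrictT _ mOmega).
  by apply: (lty_poweRy _ h); rewrite invr_neq0.
move=> [mu_ h]; rewrite /Lp /= inE; apply/andP; split; rewrite !inE/=.
  by apply/(measurable_restrictT _ mOmega).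
rewrite /finite_norm -[X in (X < _)%E]/(Lp_norm Omega 2%:E u) Lp_norm_fin// E.
exact: poweR_lty.
Qed.

Lemma Lp2_measurable u : Lp Omega 2%:E u -> measurable_fun Omega u.
Proof. by case/Lp2P. Qed.

Lemma Lp2_mul_integrable u v : Lp Omega 2%:E u -> Lp Omega 2%:E v ->
  mu.-integrable Omega (EFin \o (fun x => u x * v x)).
Proof.
move=> Lu Lv; have := Lfun2_mul_Lfun1 Lu Lv; move/Lfun1_integrable.
rewrite (_ : EFin \o _ = ((EFin \o (fun x => u x * v x)) \_ Omega)).
  by move/(integrable_mkcond _ mOmega).
apply/funext => x /=; rewrite !patchE; case: ifPn => //=; by rewrite mulr0.
Qed.

Lemma Lp2_lin a u v : Lp Omega 2%:E u -> Lp Omega 2%:E v ->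
  Lp Omega 2%:E (fun x => a * u x + v x).
Proof.
move=> Lu Lv; rewrite /Lp /=.
rewrite (_ : _ \_ Omega = a *: (u \_ Omega) + v \_ Omega).
  have p1 : (1 <= 2%:E :> \bar R)%E by rewrite lee_fin ler1n.
  by have [_] := Lfun_submod_closed mu p1; exact.
apply/funext => x; rewrite /GRing.scale/= /GRing.add/= /GRing.scale /= !patchE.
by case: ifPn => //=; rewrite mulr0 addr0.
Qed.

Lemma innerC u v : ip u v = ip v u.
Proof. by apply: eq_Rintegral => x _; rewrite mulrC. Qed.

Lemma inner_lin a u v w : Lp Omega 2%:E u -> Lp Omega 2%:E v -> Lp Omega 2%:E w ->
  ip (fun x => a * u x + v x) w = a * ip u w + ip v w.
Proof.
move=> Lu Lv Lw; rewrite /inner -RintegralZl//; last exact: Lp2_mul_integrable.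
rewrite -RintegralD//; last 2 first.
- have := integrableZl mOmega a (Lp2_mul_integrable Lu Lw).
  by apply: eq_integrable => // x _ /=; rewrite EFinM.
- exact: Lp2_mul_integrable.
by apply: eq_Rintegral => x _; rewrite mulrDl mulrA.
Qed.

Lemma Lp2_0 : Lp Omega 2%:E (fun=> 0).
Proof.
apply/Lp2P; split => //; rewrite integral0_eq// => x _; by rewrite expr0n.
Qed.

Lemma inner0l w : ip (fun=> 0) w = 0.
Proof.
rewrite /inner; under eq_Rintegral do rewrite mul0r.
by rewrite Rintegral_cst// mul0r.
Qed.

Lemma inner_ge0 u : 0 <= ip u u.
Proof. by apply: Rintegral_ge0 => x _; rewrite -expr2 sqr_ge0. Qed.

Lemma Lp_norm2 u : Lp Omega 2%:E u -> Lp_norm Omega 2%:E u = (Num.sqrt (ip u u))%:E.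
Proof.
move=> Lu; rewrite Lp_norm_fin// -powR12_sqrt ?inner_ge0// -poweR_EFin.
congr (_ `^ _)%E; rewrite /inner fineK; last first.
  by apply: integrable_fin_num => //; exact: Lp2_mul_integrable.
by apply: eq_integral => x _; rewrite powR_mulrn// real_normK ?num_real// expr2.
Qed.

(** Hölder's inequality for the zero extensions. It is stated for measurable factors with integrable
    product, so that it also serves for powers of a function, with exponents other than 2, in Nash's
    inequality. *)
Lemma inner_hoelder (p q : R) u v :
  measurable_fun Omega u -> measurable_fun Omega v ->
  mu.-integrable Omega (EFin \o (fun x => u x * v x)) ->
  0 < p -> 0 < q -> p^-1 + q^-1 = 1 ->
  (`|ip u v|%:E <= Lp_norm Omega p%:E u * Lp_norm Omega q%:E v)%E.
Proof.
move=> mu_ mv_ iuv p0 q0 pq.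
apply: (@le_trans _ _ ('N[mu]_1 [EFin \o ((u \_ Omega) \* (v \_ Omega))%R])%E).
  rewrite Lnorm1 /inner EFin_normr_Rintegral//.
  apply: le_trans (le_abse_integral _ _ _) _ => //.
    by apply/measurable_EFinP/measurable_funM.
  rewrite integral_mkcond le_eqVlt; apply/orP; left; apply/eqP.
  apply: eq_integral => x _; rewrite !patchE /= !patchE; case: ifPn => //.
  by rewrite mulr0 normr0.
by apply: hoelder => //; exact/(measurable_restrictT _ mOmega).
Qed.

Lemma le_normr_inner u v : Lp Omega 2%:E u -> Lp Omega 2%:E v ->
  (`|ip u v|%:E <= Lp_norm Omega 2%:E u * Lp_norm Omega 2%:E v)%E.
Proof.
move=> Lu Lv; apply: inner_hoelder => //; last by rewrite [RHS]splitr !div1r.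
- exact: Lp2_measurable.
- exact: Lp2_measurable.
- exact: Lp2_mul_integrable.
Qed.

(** By Cauchy-Schwarz, an L^2 limit can be tested against fixed functions; this is how identities
    for partial sums pass to the semigroup. *)
Lemma inner_cvg (f : nat -> 'rV[R]_n -> R) u g :
  (forall k, Lp Omega 2%:E (f k)) -> Lp Omega 2%:E u -> Lp Omega 2%:E g ->
  L2_cvg Omega f u -> ip (f k) g @[k --> \oo] --> ip u g.
Proof.
move=> Lf Lu Lg fu.
have Lfu k : Lp Omega 2%:E (f k \- u)%R.
  have := Lp2_lin (-1) Lu (Lf k).
  by under eq_fun do rewrite mulN1r addrC.
have fuE k : ip (f k \- u)%R g = ip (f k) g - ip u g.
  have := inner_lin (-1) Lu (Lf k) Lg.
  under eq_fun do rewrite mulN1r addrC.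
  by rewrite mulN1r addrC => <-.
have : (Lp_norm Omega 2%:E (f k \- u)%R * Lp_norm Omega 2%:E g @[k --> \oo] --> 0)%E.
  rewrite -[X in _ --> X](mul0e (Lp_norm Omega 2%:E g)) Lp_norm2//.
  by apply: cvgeZr.
move=> fu0.
have : ((`|ip (f k \- u)%R g|)%:E @[k --> \oo] --> 0)%E.
  apply: (squeeze_cvge _ (cvg_cst _) fu0).
  by apply: nearW => k; rewrite lee_fin normr_ge0/=; exact: le_normr_inner.
move/fine_cvgP => [_ h].
apply/subr_cvg0; apply/norm_cvg0P.
by move: h; apply: cvg_trans; apply: near_eq_cvg; apply: nearW => k/=; rewrite fuE.
Qed.

Lemma eq_ae_inner u v w : Lp Omega 2%:E u -> Lp Omega 2%:E v -> Lp Omega 2%:E w ->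
  ae_eq_on Omega u v -> ip u w = ip v w.
Proof.
move=> Lu Lv Lw uv; congr fine; apply: ae_eq_integral => //.
- by apply/measurable_EFinP/measurable_funM; exact: Lp2_measurable.
- by apply/measurable_EFinP/measurable_funM; exact: Lp2_measurable.
by apply: filterS uv => x /[apply] ->.
Qed.

Lemma Lp2_sum (a : nat -> R) (phi : nat -> 'rV[R]_n -> R) N :
  (forall k, (1 <= k)%N -> Lp Omega 2%:E (phi k)) ->
  Lp Omega 2%:E (fun x => \sum_(1 <= k < N.+1) a k * phi k x).
Proof.
move=> Lphi; elim: N => [|N IH].
  by under eq_fun do rewrite big_geq//; exact: Lp2_0.
under eq_fun do rewrite big_nat_recr//= addrC.
by apply: Lp2_lin => //; exact: Lphi.
Qed.

Lemma inner_suml (a : nat -> R) (phi : nat -> 'rV[R]_n -> R) N w :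
  (forall k, (1 <= k)%N -> Lp Omega 2%:E (phi k)) -> Lp Omega 2%:E w ->
  ip (fun x => \sum_(1 <= k < N.+1) a k * phi k x) w =
  \sum_(1 <= k < N.+1) a k * ip (phi k) w.
Proof.
move=> Lphi Lw; elim: N => [|N IH].
  under [in LHS]eq_fun do rewrite big_geq//.
  by rewrite big_geq// inner0l.
under [in LHS]eq_fun do rewrite big_nat_recr//= addrC.
rewrite inner_lin//; [|exact: Lphi|exact: Lp2_sum].
by rewrite IH [RHS]big_nat_recr//= addrC.
Qed.

End L2.

(** * Spectral heat semigroup *)

Section orthonormal.
Context {R : realType} {n : nat}.
Variable Omega : set 'rV[R]_n.
Hypothesis mOmega : measurable Omega.
Local Notation mu := (@lebesgue_row R n).
Local Notation ip := (inner Omega).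
Variable phi : nat -> 'rV[R]_n -> R.
Hypothesis Lphi : forall k, (1 <= k)%N -> Lp Omega 2%:E (phi k).
Hypothesis onphi : forall j k, (1 <= j)%N -> (1 <= k)%N -> ip (phi j) (phi k) = (j == k)%:R.

Lemma inner_sum_basis (a : nat -> R) N j : (1 <= j)%N ->
  ip (fun x => \sum_(1 <= k < N.+1) a k * phi k x) (phi j) =
  if (j <= N)%N then a j else 0.
Proof.
move=> j1; rewrite inner_suml//; last exact: Lphi.
under eq_big_nat => k /andP[k1 _] do rewrite onphi//.
have [jN|jN] := leqP j N.
  rewrite (bigD1_seq j) ?iota_uniq//=; last by rewrite mem_index_iota j1.
  rewrite eqxx mulr1 big1 ?addr0// => i /negPf ->; by rewrite mulr0.
rewrite big_nat_cond big1// => i /andP[/andP[_ iN] _].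
by rewrite ltn_eqF ?mulr0// (leq_trans iN).
Qed.

Lemma inner_sum_sum (a : nat -> R) N :
  ip (fun x => \sum_(1 <= k < N.+1) a k * phi k x)
     (fun x => \sum_(1 <= k < N.+1) a k * phi k x) = \sum_(1 <= k < N.+1) a k ^+ 2.
Proof.
rewrite inner_suml//; last exact: Lp2_sum.
apply: eq_big_nat => k /andP[k1 kN].
by rewrite innerC inner_sum_basis// -ltnS kN expr2.
Qed.

Lemma bessel u N : Lp Omega 2%:E u ->
  \sum_(1 <= k < N.+1) ip u (phi k) ^+ 2 <= ip u u.
Proof.
move=> Lu; set S := (X in X <= _).
pose w := fun x => \sum_(1 <= k < N.+1) ip u (phi k) * phi k x.
have Lw : Lp Omega 2%:E w by exact: Lp2_sum.
have Ld : Lp Omega 2%:E (fun x => -1 * w x + u x) by exact: Lp2_lin.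
(* The squared norm of [u - w], with [w] the projection of [u] onto the first [N] basis functions,
   expands to [ip u u - S], since [ip w w] and [ip w u] both equal [S]. *)
have := inner_ge0 Omega (fun x => -1 * w x + u x).
rewrite inner_lin// !(innerC Omega _ (fun x => _ + _)) !inner_lin//.
rewrite (innerC _ u w) [ip w w]inner_sum_sum -/S.
have -> : ip w u = S.
  rewrite inner_suml//; apply: eq_big_nat => k _.
  by rewrite innerC expr2.
lra.
Qed.

Lemma Lp2_fourier_sum a u N : Lp Omega 2%:E (fourier_sum Omega phi a u N).
Proof. exact: Lp2_sum. Qed.

Lemma inner_fourier_sum a u N g : Lp Omega 2%:E g ->
  ip (fourier_sum Omega phi a u N) g =
  \sum_(1 <= k < N.+1) a k * ip u (phi k) * ip (phi k) g.
Proof. by move=> Lg; rewrite /fourier_sum inner_suml. Qed.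

(** By orthonormality the coefficient of the partial sums along [phi k] is constant from [N = k] on,
    so its limit is known. *)
Lemma heat_inner lam t u v k : (1 <= k)%N ->
  heat_semigroup Omega lam phi t u v ->
  ip v (phi k) = expR (- lam k * t) * ip u (phi k).
Proof.
move=> k1 [Lv cv].
have /(_ _ (Lphi k1)) := inner_cvg mOmega (Lp2_fourier_sum _ u) Lv _ cv.
move/cvg_lim => <-//; apply/cvg_lim => //.
apply: cvg_near_cst; near=> N; rewrite inner_sum_basis//.
by rewrite ifT//; near: N; exact: nbhs_infty_ge.
Unshelve. all: by end_near. Qed.

(** Each partial sum is a symmetric bilinear expression in the coefficients of [f] and [g]; symmetry
    survives the limit. *)
Lemma heat_symmetric lam t f g v w :
  Lp Omega 2%:E f -> Lp Omega 2%:E g ->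
  heat_semigroup Omega lam phi t f v -> heat_semigroup Omega lam phi t g w ->
  ip v g = ip f w.
Proof.
move=> Lf Lg [Lv cv] [Lw cw].
have h1 := inner_cvg mOmega (Lp2_fourier_sum _ f) Lv Lg cv.
have h2 := inner_cvg mOmega (Lp2_fourier_sum _ g) Lw Lf cw.
rewrite (innerC _ f); apply: (cvg_unique _ h1) => //.
move: h2; apply: cvg_trans; apply: near_eq_cvg; apply: nearW => N.
rewrite !inner_fourier_sum//; apply: eq_big_nat => k _.
by rewrite mulrAC -!mulrA (innerC _ f) (innerC _ g) (mulrC (ip (phi k) f)).
Qed.

(* Compactness of the Green operator replaces completeness of L^2: it is applied to the
   partial sums of [lam k * exp(- lam k t) <u, phi k> phi k], bounded in L^2 for [t > 0]. *)
Lemma heat_semigroup_exists G lam t u : 0 < t ->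
  (forall k, (1 <= k)%N -> 0 < lam k) ->
  green_setting Omega G lam phi -> Lp Omega 2%:E u ->
  exists v, heat_semigroup Omega lam phi t u v.
Proof.
move=> t0 lam0 [_ L2G [cG sG] _ [[_ _ cphi] eG _ _ _]] Lu.
pose a k := lam k * expR (- lam k * t).
pose f := fourier_sum Omega phi a u.
have Lf j : Lp Omega 2%:E (f j) by exact: Lp2_fourier_sum.
(* With [x = lam k * t] this is [x <= exp x], a consequence of [1 + x <= exp x]. *)
have a_le k : (1 <= k)%N -> 0 <= a k <= t^-1.
  move=> k1; rewrite /a mulr_ge0 ?expR_ge0 ?(ltW (lam0 _ k1))//=.
  rewrite mulNr expRN ler_pdivrMr ?expR_gt0// ler_pdivlMl//.
  by apply: le_trans (expR_ge1Dx _); rewrite mulrC lerDr.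
have [] := cG f Lf.
  exists (Num.sqrt (t^-1 ^+ 2 * ip u u)) => j.
  rewrite Lp_norm2// lee_fin ler_wsqrtr//.
  rewrite [leLHS]inner_sum_sum; apply: (@le_trans _ _
      (\sum_(1 <= k < j.+1) t^-1 ^+ 2 * ip u (phi k) ^+ 2)).
    rewrite big_nat [leRHS]big_nat; apply: ler_sum => k /andP[k1 _].
    rewrite exprMn ler_wpM2r ?sqr_ge0// ler_pXn2r// ?nnegrE ?invr_ge0 ?(ltW t0)//.
      by case/andP: (a_le _ k1).
    by case/andP: (a_le _ k1).
  by rewrite -mulr_sumr ler_wpM2l ?sqr_ge0// bessel.
move=> sigma [v [sigma_incr Lv cv]].
have sigma_ge j : (j <= sigma j)%N.
  by elim: j => // j IH; apply: leq_ltn_trans IH _; exact: sigma_incr.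
exists v; split => //.
(* Self-adjointness moves the Green operator onto [phi k], where it acts as [(lam k)^-1]; this
   cancels the factor [lam k] of [a k] and leaves the heat coefficient. *)
have vE k : (1 <= k)%N -> ip v (phi k) = expR (- lam k * t) * ip u (phi k).
  move=> k1.
  have LG j : Lp Omega 2%:E (green_op Omega G (f (sigma j))) by case: (L2G _ (Lf (sigma j))).
  have := inner_cvg mOmega LG Lv (Lphi k1) cv.
  move/cvg_lim => <-//; apply/cvg_lim => //.
  apply: cvg_near_cst; near=> N.
  have Lphik : Lp Omega 2%:E (fun x => (lam k)^-1 * phi k x + 0).
    by apply: Lp2_lin => //; [exact: Lphi|exact: Lp2_0].
  rewrite sG//; last exact: Lphi.
  rewrite innerC (eq_ae_inner mOmega _ Lphik (Lf _)); last 2 first.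
  - by case: (L2G _ (Lphi k1)).
  - by apply: filterS (eG _ k1) => x /[apply] ->; rewrite addr0.
  rewrite inner_lin//; [|exact: Lphi|exact: Lp2_0].
  rewrite inner0l// addr0 innerC inner_sum_basis// ifT; last first.
    apply: leq_trans (sigma_ge N); near: N; exact: nbhs_infty_ge.
  by rewrite /a !mulrA mulVf ?mul1r// gt_eqF// lam0.
(* The heat partial sums of [u] are thus the Fourier partial sums of [v], which converge to [v] by
   completeness of the basis. *)
suff <- : fourier_sum Omega phi (fun=> 1) v =
    fourier_sum Omega phi (fun k => expR (- lam k * t)) u by exact: cphi.
apply/funext => N; apply/funext => x.
by apply: eq_big_nat => k /andP[k1 _]; rewrite vE// mul1r.
Unshelve. all: by end_near. Qed.

End orthonormal.

(** * Nash inequality and decay of the semigroup *)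

(* Dyadic substitute for the differential inequality [y' <= - c y^(1+nu)]: if
   [w t = y t * t^(1/nu) / D > 1] then [w (t / 2^j) >= w t > 1] for all [j],
   although [w] tends to 0 at 0. *)
Lemma dyadic_decay (R : realType) (y : R -> R) (nu C K : R) : 0 < nu -> 0 < C ->
  (forall t, 0 < t -> 0 <= y t <= K) ->
  (forall t, 0 < t -> y t `^ (1 + nu) <= C * t^-1 * y (t / 2)) ->
  forall t, 0 < t -> y t <= (C * 2 `^ nu^-1) `^ nu^-1 * t `^ (- nu^-1).
Proof.
move=> nu0 C0 yK yC t t0.
(* [D] is chosen so that its power [nu] is [E]: the normalized function [w] below then satisfies the
   halving inequality [w2] with constant exactly 1. *)
set E := C * 2 `^ nu^-1; set D := E `^ nu^-1.
have E0 : 0 < E by rewrite mulr_gt0// powR_gt0.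
have D0 : 0 < D by rewrite powR_gt0.
have nuV : nu^-1 * nu = 1 by rewrite mulVf// gt_eqF.
have DE : D `^ nu = E by rewrite /D -powRrM nuV powRr1// ltW.
pose w r := y r * r `^ nu^-1 / D.
have w0 r : 0 < r -> 0 <= w r.
  move=> r0; rewrite /w divr_ge0 ?(ltW D0)// mulr_ge0 ?powR_ge0//.
  by case/andP: (yK _ r0).
have w2 r : 0 < r -> w r `^ (1 + nu) <= w (r / 2).
  move=> r0; have /andP[y0 _] := yK _ r0.
  have nu10 : 1 + nu != 0 by rewrite gt_eqF// addr_gt0.
  rewrite /w powRM ?mulr_ge0 ?powR_ge0 ?invr_ge0 ?(ltW D0)//.
  rewrite powRM ?powR_ge0//.
  apply: (@le_trans _ _ (C * r^-1 * y (r / 2) * (r `^ nu^-1) `^ (1 + nu) * D^-1 `^ (1 + nu))).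
    by rewrite ler_wpM2r ?powR_ge0// ler_wpM2r ?powR_ge0// yC.
  rewrite le_eqVlt; apply/orP; left; apply/eqP.
  have -> : (r `^ nu^-1) `^ (1 + nu) = r `^ nu^-1 * r.
    rewrite -powRrM mulrDr mulr1 nuV powRD; last by rewrite (gt_eqF r0) implybT.
    by rewrite powRr1// ltW.
  have -> : D^-1 `^ (1 + nu) = D^-1 * E^-1.
    rewrite powRD; last by rewrite invr_eq0 (gt_eqF D0) implybT.
    rewrite powRr1 ?invr_ge0 ?(ltW D0)//; congr (_ * _).
    by rewrite -DE -[D^-1]powR_inv1 ?(ltW D0)// -powRrM mulN1r powRN.
  rewrite powRM ?invr_ge0 ?(ltW r0)//.
  have -> : 2^-1 `^ nu^-1 = (2 `^ nu^-1)^-1 :> R.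
    by rewrite -powR_inv1// -powRrM mulN1r powRN.
  have p20 : 2 `^ nu^-1 != 0 :> R by rewrite gt_eqF// powR_gt0.
  have C00 : C != 0 by rewrite gt_eqF.
  have r00 : r != 0 by rewrite gt_eqF.
  have D00 : D != 0 by rewrite gt_eqF.
  by rewrite /E; field; rewrite p20 C00 D00 r00.
have wK r : 0 < r -> w r <= K * r `^ nu^-1 / D.
  move=> r0; rewrite /w ler_wpM2r ?invr_ge0 ?(ltW D0)// ler_wpM2r ?powR_ge0//.
  by case/andP: (yK _ r0).
suff wt : w t <= 1.
  rewrite powRN ler_pdivlMr ?powR_gt0//.
  by move: wt; rewrite /w ler_pdivrMr// mul1r.
rewrite leNgt; apply/negP => wt1.
have t2 j : 0 < t / 2 ^+ j by rewrite divr_gt0// exprn_gt0.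
have wj j : 1 < w (t / 2 ^+ j).
  elim: j => [|j IH]; first by rewrite expr0 divr1.
  rewrite exprSr invfM mulrA; apply: lt_le_trans (w2 _ (t2 j)).
  (* A number above 1 is at most its power of exponent [1 + nu]. *)
  apply: (lt_le_trans IH); rewrite -[leLHS]powRr1 ?w0//.
  by apply: ler_powR; [exact: ltW|rewrite lerDl ltW].
(* The bound [wK] along the points [t / 2 ^+ j] is geometric, with ratio the inverse of 2 to the
   power [nu^-1], hence below 1; eventually it contradicts [wj]. *)
have /cvgrPdist_lt/(_ _ ltr01) : (fun j => K * (t / 2 ^+ j) `^ nu^-1 / D) @ \oo --> K * 0 / D.
  apply: cvgMl; apply: cvgMr.
  have -> : (fun j => (t / 2 ^+ j) `^ nu^-1) = (fun j => t `^ nu^-1 * ((2 `^ nu^-1)^-1) ^+ j).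
    apply/funext => j; rewrite powRM ?invr_ge0 ?(ltW t0) ?exprn_ge0//; congr (_ * _).
    have -> : (2 `^ nu^-1)^-1 = 2^-1 `^ nu^-1 :> R.
      by rewrite -[2^-1]powR_inv1// -powRrM mulN1r powRN.
    by rewrite -exprVn -!powR_mulrn ?powR_ge0// powRAC.
  rewrite -[X in _ --> X](mulr0 (t `^ nu^-1)); apply: cvgMr; apply: cvg_expr.
  rewrite ger0_norm ?invr_ge0 ?powR_ge0// invf_lt1 ?powR_gt0//.
  have : 1 `^ nu^-1 < 2 `^ nu^-1 :> R.
    by apply: gt0_ltr_powR; rewrite ?nnegrE ?invr_gt0 ?ltr1n.
  by rewrite powR1.
move=> [j _ /(_ j (leqnn j))].
rewrite mulr0 mul0r sub0r normrN => h.
have := le_lt_trans (le_trans (wK _ (t2 j)) (ler_norm _)) h.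
by move=> /(lt_trans (wj j)); rewrite ltxx.
Qed.

Section nash.
Context {R : realType} {n : nat}.
Variable Omega : set 'rV[R]_n.
Hypothesis mOmega : measurable Omega.
Local Notation mu := (@lebesgue_row R n).
Local Notation ip := (inner Omega).
Hypothesis fOmega : (mu Omega < +oo)%E.
Implicit Types u v w : 'rV[R]_n -> R.

Lemma Lp2_bounded u : measurable_fun Omega u ->
  (forall x, 0 <= u x <= 1) -> Lp Omega 2%:E u.
Proof.
move=> mu_ u01; apply/Lp2P => //; split => //.
apply: le_lt_trans fOmega.
rewrite -[leRHS]mul1e -integral_cst//; apply: ge0_le_integral => //.
- by move=> x _; rewrite lee_fin sqr_ge0.
- by apply/measurable_EFinP; exact: measurable_funX.
- by move=> x _; rewrite lee_fin; have /andP[? ?] := u01 x; rewrite exprn_ile1.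
Qed.

(** The Markov property bounds a representative only almost everywhere. Truncating it to [0, 1]
    yields a function bounded at every point with the same inner products, so that its real powers
    can be handled pointwise. *)
Lemma Lp2_clamp v : Lp Omega 2%:E v ->
  {ae mu, forall x, Omega x -> 0 <= v x <= 1} ->
  exists w, [/\ Lp Omega 2%:E w, forall x, 0 <= w x <= 1 &
    forall g, Lp Omega 2%:E g -> ip v g = ip w g].
Proof.
move=> Lv v01; pose w x := Num.max 0 (Num.min (v x) 1).
have w01 x : 0 <= w x <= 1.
  by rewrite /w le_max lexx/= ge_max ler01/= ge_min lexx orbT.
have Lw : Lp Omega 2%:E w.
  apply: Lp2_bounded => //; apply: measurable_maxr => //.
  by apply: measurable_minr => //; exact: Lp2_measurable.
exists w; split => // g Lg; apply: eq_ae_inner => //.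
apply: filterS v01 => x /[apply] /andP[v0 v1].
by rewrite /w (min_idPl v1) (max_idPr v0).
Qed.

(** Interpolation of L^2 between L^1 and the Sobolev exponent, the latter norm being controlled by
    the energy. As [v] is nonnegative, [ip v (fun=> 1)] is its L^1 norm. *)
Lemma nash (s CS E : R) lam phi v : 0 < s < 1 -> 2 * s < n%:R ->
  sobolev_constant Omega s lam phi CS ->
  Lp Omega 2%:E v -> (forall x, 0 <= v x <= 1) ->
  (0 <= energy Omega lam phi v <= E%:E)%E ->
  ip v v `^ (1 + 2 * s / n%:R) <=
  ip v (fun=> 1) `^ (2 * (2 * s / n%:R)) * (E / CS ^+ 2).
Proof.
move=> /andP[s0 s1] ns [CS0 sob] Lv v01 /andP[e0 Ev].
have E0 : 0 <= E by rewrite -lee_fin (le_trans e0).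
set m : R := n%:R; have m0 : 0 < m by lra.
(* The exponents satisfy [a + b = 2], [a + (q - 1)^-1 = 1] and [b * (q - 1) = q]: Hölder applied to
   the powers [a] and [b] of [v] produces exactly the L^1 and L^q norms of [v]. *)
pose a := 4 * s / (m + 2 * s); pose b := 2 * m / (m + 2 * s).
pose q := 2 * m / (m - 2 * s).
have ms0 : 0 < m + 2 * s by lra.
have ms1 : 0 < m - 2 * s by rewrite subr_gt0.
have a0 : 0 < a by rewrite divr_gt0//; lra.
have b0 : 0 < b by rewrite divr_gt0//; lra.
have q0 : 0 < q by rewrite divr_gt0//; lra.
have msN : m + 2 * s != 0 by rewrite gt_eqF.
have msN' : m - 2 * s != 0 by rewrite gt_eqF.
have mN : m != 0 by rewrite gt_eqF.
have q1E : q - 1 = (m + 2 * s) / (m - 2 * s) by rewrite /q; field; rewrite ?msN ?msN' ?mN.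
have q10 : 0 < q - 1 by rewrite q1E divr_gt0.
have L1 : Lp Omega 2%:E (fun=> 1) by apply: Lp2_bounded => // x; rewrite ler01 lexx.
have mpow c : measurable_fun Omega (fun x => v x `^ c).
  by apply: (measurableT_comp (measurable_powR _)) => //; exact: Lp2_measurable.
have vab x : v x `^ a * v x `^ b = v x * v x.
  rewrite -powRD; last first.
    by rewrite (_ : a + b = 2) ?pnatr_eq0// /a /b; field; rewrite ?msN ?msN' ?mN.
  have -> : a + b = 2 by rewrite /a /b; field; rewrite ?msN ?msN' ?mN.
  by rewrite powR_mulrn ?expr2//; case/andP: (v01 x).
have ipab : ip (fun x => v x `^ a) (fun x => v x `^ b) = ip v v.
  by apply: eq_Rintegral => x _; rewrite vab.
have : (`|ip (fun x => v x `^ a) (fun x => v x `^ b)|%:E <=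
   Lp_norm Omega a^-1%:E (fun x => v x `^ a)%R *
   Lp_norm Omega (q - 1)%:E (fun x => v x `^ b)%R)%E.
  apply: inner_hoelder => //.
  - under eq_fun do rewrite vab; exact: Lp2_mul_integrable.
  - by rewrite invr_gt0.
  - by rewrite invrK q1E /a; field; rewrite ?msN ?msN' ?mN.
rewrite ipab ger0_norm ?inner_ge0//.
have -> : (Lp_norm Omega a^-1%:E (fun x => v x `^ a)%R = (ip v (fun=> 1) `^ a)%:E)%E.
  rewrite Lp_norm_fin ?invr_eq0 ?gt_eqF// invrK -poweR_EFin; congr (_ `^ _)%E.
  rewrite /inner fineK; last by apply: integrable_fin_num => //; exact: Lp2_mul_integrable.
  apply: eq_integral => x _; rewrite mulr1 ger0_norm ?powR_ge0// -powRrM mulfV ?gt_eqF//.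
  by rewrite powRr1//; case/andP: (v01 x).
have -> : (Lp_norm Omega (q - 1)%:E (fun x => v x `^ b)%R = (Lp_norm Omega q%:E v) `^ b)%E.
  rewrite !Lp_norm_fin ?gt_eqF// -poweRrM; congr (_ `^ _)%E; last first.
    by rewrite q1E /q /b; field; rewrite ?msN ?msN' ?mN.
  apply: eq_integral => x _; rewrite ger0_norm ?powR_ge0// -powRrM.
  have /andP[? _] := v01 x; rewrite ger0_norm//; congr EFin; congr (_ `^ _)%R.
  by rewrite q1E /b /q; field; rewrite ?msN ?msN' ?mN.
have Nq : (Lp_norm Omega q%:E v <= (Num.sqrt E / CS)%:E)%E.
  have := sob v Lv (le_lt_trans Ev (ltry _)).
  rewrite -/m -/q => h.
  rewrite [Num.sqrt E / CS]mulrC (EFinM CS^-1) lee_pdivlMl//; apply: (le_trans h).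
  rewrite -powR12_sqrt// -poweR_EFin; apply: gt0_ler_poweR => //.
  - by rewrite in_itv/= leey e0.
  - by rewrite in_itv/= leey lee_fin E0.
have r0 : 0 <= Num.sqrt E / CS by rewrite divr_ge0 ?sqrtr_ge0 ?(ltW CS0).
have I0 : 0 <= ip v (fun=> 1).
  by apply: Rintegral_ge0 => x _; rewrite mulr1; case/andP: (v01 x).
move=> h; have {h} : ip v v <= ip v (fun=> 1) `^ a * (Num.sqrt E / CS) `^ b.
  rewrite -lee_fin; apply: (le_trans h); rewrite (EFinM (_ `^ a)).
  rewrite lee_wpmul2l// ?lee_fin ?powR_ge0//.
  rewrite -poweR_EFin; apply: gt0_ler_poweR => //; first exact: ltW.
    by rewrite in_itv/= leey Lnorm_ge0.
  by rewrite in_itv/= leey lee_fin r0.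
(* Raising to the power [1 + 2 * s / m] turns the exponent [b] into 2, which removes the square root
   of [E], and turns [a] into [2 * (2 * s / m)]. *)
move=> h; apply: (@le_trans _ _
    ((ip v (fun=> 1) `^ a * (Num.sqrt E / CS) `^ b) `^ (1 + 2 * s / m))).
  have n0 : 0 <= 1 + 2 * s / m by rewrite addr_ge0// divr_ge0// ltW//; lra.
  by apply: ge0_ler_powR; rewrite ?nnegrE ?inner_ge0 ?mulr_ge0 ?powR_ge0.
rewrite powRM ?powR_ge0// -!powRrM.
have -> : a * (1 + 2 * s / m) = 2 * (2 * s / m) by rewrite /a; field; rewrite ?msN ?msN' ?mN.
have -> : b * (1 + 2 * s / m) = 2 by rewrite /b; field; rewrite ?msN ?msN' ?mN.
by rewrite powR_mulrn// expr_div_n sqr_sqrtr.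
Qed.

End nash.

(** * Monotonicity and positivity of the eigenvalues *)

Section eigenvalues.
Context {R : realType}.
Variable lam : nat -> R.
Hypothesis lam12 : 0 < lam 1%N < lam 2%N.
Hypothesis lamS : forall k, (2 <= k)%N -> lam k <= lam k.+1.

Lemma eigen_le j k : (1 <= j)%N -> (j <= k)%N -> lam j <= lam k.
Proof.
move=> j1 /subnKC <-; elim: (k - j)%N => [|i IH]; first by rewrite addn0.
apply: (le_trans IH); rewrite addnS.
have [|h] := leqP 2 (j + i); first exact: lamS.
(* The step from index 1 to index 2 is not an instance of [lamS]; it comes from the spectral gap
   [lam12]. *)
have -> : (j + i = 1)%N by apply/eqP; rewrite eqn_leq -ltnS h addn_gt0 j1.
by case/andP: lam12 => _ /ltW.
Qed.

Lemma eigen_gt0 k : (1 <= k)%N -> 0 < lam k.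
Proof. by case/andP: lam12 => l1 _ k1; exact/(lt_le_trans l1)/eigen_le. Qed.

End eigenvalues.

(** * Coefficients of indicator functions along the first eigenfunctions *)

Section coefficient_bound.
Context {R : realType} {n : nat}.
Variable Omega : set 'rV[R]_n.
Hypothesis mOmega : measurable Omega.
Local Notation mu := (@lebesgue_row R n).
Local Notation ip := (inner Omega).
Hypothesis fOmega : (mu Omega < +oo)%E.
Variables (s CS : R) (G : 'rV[R]_n -> 'rV[R]_n -> \bar R).
Variables (lam : nat -> R) (phi : nat -> 'rV[R]_n -> R).
Hypotheses (s01 : 0 < s < 1) (ns : 2 * s < n%:R).
Hypothesis gs : green_setting Omega G lam phi.
Hypothesis sob : sobolev_constant Omega s lam phi CS.
Hypothesis markov : sub_markovian Omega lam phi.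
Local Notation nu := (2 * s / n%:R).

Lemma heat_indicator A t : measurable A -> A `<=` Omega -> 0 < t ->
  exists v : 'rV[R]_n -> R, [/\ Lp Omega 2%:E v, forall x, 0 <= v x <= 1,
    forall k, (1 <= k)%N -> ip v (phi k) = expR (- lam k * t) * ip \1_A (phi k) &
    ip v (fun=> 1) <= fine (mu A)].
Proof.
move=> mA AO t0.
have [_ _ _ _ [[Lphi onphi _] _ l12 lS _]] := gs.
have lam0 := eigen_gt0 l12 lS.
have L1 : Lp Omega 2%:E (fun=> 1 : R).
  by apply: Lp2_bounded => // x; rewrite ler01 lexx.
have A01 x : 0 <= (\1_A x : R) <= 1 by rewrite indicE; case: (_ \in _); rewrite ?lexx ?ler01.
have LA : Lp Omega 2%:E (\1_A : _ -> R).
  exact: Lp2_bounded.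
have le1 : 0 <= (1 : R) <= 1 by rewrite ler01 lexx.
have [v0 hv0] := heat_semigroup_exists mOmega Lphi onphi t0 lam0 gs LA.
have [w0 hw0] := heat_semigroup_exists mOmega Lphi onphi t0 lam0 gs L1.
have v01 := markov (ltW t0) LA hv0 (aeW _ (fun x _ => A01 x)).
have w01 := markov (ltW t0) L1 hw0 (aeW _ (fun _ _ => le1)).
have [v [Lv v1 vE]] := Lp2_clamp mOmega fOmega (proj1 hv0) v01.
have [w [Lw w1 wE]] := Lp2_clamp mOmega fOmega (proj1 hw0) w01.
exists v; split => //.
  by move=> k k1; rewrite -vE ?(heat_inner mOmega Lphi onphi k1 hv0)//; exact: Lphi.
(* Symmetry transfers the semigroup from the indicator to the constant 1, whose image is at most
   1. *)
rewrite -vE// (heat_symmetric mOmega Lphi LA L1 hv0 hw0) innerC wE// innerC.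
apply: (@le_trans _ _ (ip (\1_A) (fun=> 1))).
  apply: le_Rintegral => //; [exact: Lp2_mul_integrable|exact: Lp2_mul_integrable|].
  move=> x _; have /andP[_ w_le1] := w1 x; have /andP[A_ge0 _] := A01 x.
  exact: ler_wpM2l.
rewrite /inner; under eq_Rintegral do rewrite mulr1.
by rewrite /Rintegral integral_indic// setIidl.
Qed.

(** Heat flow up to time [(lam N)^-1] damps the first [N] coefficients by at most a factor
    [exp(-1)], while Nash's inequality makes the squared norm decay with a constant quadratic in the
    measure of [A]. *)
Lemma indicator_coefficients A N : measurable A -> A `<=` Omega -> (0 < mu A)%E ->
  (1 <= N)%N ->
  \sum_(1 <= k < N.+1) ip \1_A (phi k) ^+ 2 <=
  expR 2 * ((CS ^- 2 * 2 `^ nu^-1) `^ nu^-1 * lam N `^ nu^-1) * fine (mu A) ^+ 2.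
Proof.
move=> mA AO A0 N1.
have [_ _ _ _ [[Lphi onphi _] _ l12 lS _]] := gs.
have lam0 := eigen_gt0 l12 lS.
have CS0 : 0 < CS by case: sob.
have /andP[s0 _] := s01.
have n0 : 0 < n%:R :> R by apply: lt_trans ns; rewrite mulr_gt0.
have nu0 : 0 < nu by rewrite divr_gt0 ?mulr_gt0.
set m := fine (mu A).
have m0 : 0 < m.
  by rewrite fine_gt0// A0/=; apply: le_lt_trans fOmega; apply: le_measure; rewrite ?inE.
have L1 : Lp Omega 2%:E (fun=> 1 : R).
  by apply: Lp2_bounded => // x; rewrite ler01 lexx.
have /choice[v vP] t : exists v : 'rV[R]_n -> R, 0 < t ->
   [/\ Lp Omega 2%:E v, forall x, 0 <= v x <= 1,
    forall k, (1 <= k)%N -> ip v (phi k) = expR (- lam k * t) * ip \1_A (phi k) &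
    ip v (fun=> 1) <= m].
  (* The zero function is a dummy value at nonpositive times, which lets [choice] give a function of
     all real [t]. *)
  have [t0|t0] := ltP 0 t; last by exists (fun=> 0).
  by have [w ?] := heat_indicator mA AO t0; exists w.
pose y t := ip (v t) (v t).
have yK t : 0 < t -> 0 <= y t <= m.
  move=> t0; have [Lv v01 _ vm] := vP _ t0; rewrite inner_ge0/=; apply: le_trans vm.
  apply: le_Rintegral => //; [exact: Lp2_mul_integrable|exact: Lp2_mul_integrable|].
  by move=> x _; have /andP[? ?] := v01 x; rewrite ler_wpM2l.
have yC t : 0 < t -> y t `^ (1 + nu) <= (m `^ (2 * nu) * CS ^- 2) * t^-1 * y (t / 2).
  move=> t0; have [Lv v01 vk vm] := vP _ t0.
  have t20 : 0 < t / 2 by rewrite divr_gt0.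
  have [Lv2 _ vk2 _] := vP _ t20.
  have e0 k : (1 <= k)%N -> (0 <= (lam k * ip (v t) (phi k) ^+ 2)%:E)%E.
    by move=> k1; rewrite lee_fin mulr_ge0 ?sqr_ge0 ?(ltW (lam0 _ k1)).
  have := nash mOmega fOmega s01 ns sob Lv v01 (E := t^-1 * y (t / 2)).
  have -> : (0%:E <= energy Omega lam phi (v t) <= (t^-1 * y (t / 2))%:E)%E.
    apply/andP; split; first by apply: nneseries_ge0 => k k1 _; exact: e0.
    apply: lime_le; first by apply: is_cvg_nneseries => k k1 _; exact: e0.
    (* The upper summation bound is exclusive; 0 is split off so that the other partial sums have
       the form used in [bessel]. *)
    apply: nearW => -[|M].
      by rewrite big_geq// lee_fin mulr_ge0 ?invr_ge0 ?inner_ge0 ?(ltW t0).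
    rewrite sumEFin lee_fin.
    apply: le_trans (_ : t^-1 * \sum_(1 <= k < M.+1) ip (v (t / 2)) (phi k) ^+ 2 <= _).
      rewrite mulr_sumr big_nat [leRHS]big_nat; apply: ler_sum => k /andP[k1 _].
      rewrite vk// vk2// !exprMn mulrA [leRHS]mulrA ler_wpM2r ?sqr_ge0//.
      rewrite -!expRM_natl.
      (* Half of the damping absorbs [lam k] at the cost of [t^-1]; the other half is the squared
         damping at time [t / 2]. *)
      have -> : 2%:R * (- lam k * t) = - (lam k * t) + 2%:R * (- lam k * (t / 2)) by field.
      rewrite expRD mulrA ler_wpM2r ?expR_ge0//.
      rewrite expRN ler_pdivrMr ?expR_gt0// ler_pdivlMl//.
      by apply: le_trans (expR_ge1Dx _); rewrite mulrC lerDr.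
    by rewrite ler_wpM2l ?invr_ge0 ?(ltW t0)// bessel.
  move=> /(_ isT) h; apply: (le_trans h).
  have I0 : 0 <= ip (v t) (fun=> 1).
    by apply: Rintegral_ge0 => x _; rewrite mulr1; case/andP: (v01 x).
  apply: (@le_trans _ _ (m `^ (2 * nu) * (t^-1 * y (t / 2) / CS ^+ 2))).
    apply: ler_wpM2r.
      by rewrite !mulr_ge0 ?invr_ge0 ?inner_ge0 ?sqr_ge0 ?(ltW t0).
    have nu20 : 0 <= 2 * nu by rewrite mulr_ge0// ltW.
    by apply: ge0_ler_powR; rewrite ?nnegrE ?(ltW m0).
  by rewrite le_eqVlt; apply/orP; left; apply/eqP; ring.
have C0 : 0 < m `^ (2 * nu) * CS ^- 2 by rewrite mulr_gt0 ?powR_gt0 ?invr_gt0 ?exprn_gt0.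
have tN : 0 < (lam N)^-1 by rewrite invr_gt0 lam0.
have := dyadic_decay nu0 C0 yK yC tN.
rewrite (_ : _ `^ (- nu^-1) = lam N `^ nu^-1); last first.
  by rewrite -powR_inv1 ?(ltW (lam0 _ N1))// -powRrM mulN1r opprK.
(* The power [nu^-1] of the decay constant turns the exponent [2 * nu] of [m] into 2, and the
   remaining factor no longer involves [A]. *)
rewrite -mulrA powRM ?powR_ge0 ?mulr_ge0 ?powR_ge0 ?invr_ge0 ?sqr_ge0//.
rewrite -powRrM (_ : 2 * nu * nu^-1 = 2); last by rewrite mulfK// gt_eqF.
rewrite powR_mulrn ?(ltW m0)// => yN.
apply: (@le_trans _ _ (expR 2 * y (lam N)^-1)); last first.
  by rewrite -[leRHS]mulrA ler_wpM2l ?expR_ge0// mulrC mulrA.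
have [Lv _ vk _] := vP _ tN.
(* For [k <= N] the ratio [lam k / lam N] is at most 1, so [expR 2] compensates the squared damping
   factor. *)
apply: le_trans (_ : expR 2 * \sum_(1 <= k < N.+1) ip (v (lam N)^-1) (phi k) ^+ 2 <= _).
  rewrite mulr_sumr big_nat [leRHS]big_nat; apply: ler_sum => k /andP[k1 kN].
  rewrite vk// exprMn mulrA ler_peMl ?sqr_ge0//.
  rewrite -expRM_natl -expRD -[leLHS]expR0 ler_expR.
  rewrite mulNr mulrN subr_ge0 ler_piMr// ler_pdivrMr ?lam0// mul1r.
  exact: (eigen_le l12 lS).
by rewrite ler_wpM2l ?expR_ge0// bessel.
Qed.

End coefficient_bound.

(** * Pointwise bound on the sum of squared eigenfunctions *)

Section pointwise.
Context {R : realType} {n : nat}.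
Variable Omega : set 'rV[R]_n.
Hypothesis mOmega : measurable Omega.
Local Notation mu := (@lebesgue_row R n).
Local Notation ip := (inner Omega).
Hypothesis fOmega : (mu Omega < +oo)%E.
Variable phi : nat -> 'rV[R]_n -> R.
Hypothesis Lphi : forall k, (1 <= k)%N -> Lp Omega 2%:E (phi k).

(** The hypothesis is tested on the set [A] where the inequality fails: the excess [g] is positive
    on [A], yet its integral over [A] turns out to be at most 0, so [A] is null. *)
Lemma ae_lincomb_le (a : nat -> R) N M : 0 <= M ->
  (forall A, measurable A -> A `<=` Omega -> (0 < mu A)%E ->
    \sum_(1 <= k < N.+1) ip \1_A (phi k) ^+ 2 <= M * fine (mu A) ^+ 2) ->
  {ae mu, forall x, Omega x ->
    2 * \sum_(1 <= k < N.+1) a k * phi k x - \sum_(1 <= k < N.+1) a k ^+ 2 <= M}.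
Proof.
move=> M0 HM.
pose u x := \sum_(1 <= k < N.+1) a k * phi k x.
pose c := \sum_(1 <= k < N.+1) a k ^+ 2.
have Lu : Lp Omega 2%:E u by exact: Lp2_sum.
have L1 : Lp Omega 2%:E (fun=> 1 : R).
  by apply: Lp2_bounded => // x; rewrite ler01 lexx.
have Lc : Lp Omega 2%:E (fun=> - (c + M) * 1).
  have := Lp2_lin (- (c + M)) L1 (Lp2_0 mOmega).
  by under eq_fun do rewrite addr0.
pose g x := 2 * u x + (- (c + M)) * 1.
have Lg : Lp Omega 2%:E g.
  exact: (Lp2_lin 2 Lu Lc).
pose A := Omega `&` [set x | 0 < g x].
have mA : measurable A.
  have := Lp2_measurable mOmega Lg mOmega (measurable_itv `]0, +oo[).
  by congr (measurable (_ `&` _)); apply/seteqP; split=> x /=; rewrite in_itv/= andbT.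
have AO : A `<=` Omega by move=> x [].
suff A0 : mu A = 0%E.
  exists A; split => // x /= /not_implyP[Ox /negP]; rewrite -ltNge => gx.
  split => //=; rewrite /g /u; move: gx; rewrite -/c; lra.
apply/eqP; apply: contraT => An0.
have {}A0 : (0 < mu A)%E by rewrite lt0e An0 measure_ge0.
have Afin : (mu A < +oo)%E by apply: le_lt_trans fOmega; apply: le_measure; rewrite ?inE.
set m := fine (mu A); have m0 : 0 < m by rewrite fine_gt0// A0.
have LA : Lp Omega 2%:E (\1_A : _ -> R).
  by apply: Lp2_bounded => // x; rewrite indicE; case: (_ \in _); rewrite ?lexx ?ler01.
have ipA1 : ip (\1_A) (fun=> 1) = m.
  rewrite /inner; under eq_Rintegral do rewrite mulr1.
  by rewrite /Rintegral integral_indic// setIidl.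
have gle : ip g (\1_A) <= 0.
  have -> : ip g (\1_A) = 2 * \sum_(1 <= k < N.+1) a k * ip (\1_A) (phi k) - (c + M) * m.
    rewrite /g inner_lin//.
    have -> : ip (fun=> - (c + M) * 1) (\1_A) = - ((c + M) * m).
      rewrite -mulNr -ipA1 (innerC _ _ (fun=> 1)) -[RHS]addr0 -(inner0l mOmega (\1_A)).
      rewrite -inner_lin//; last exact: Lp2_0.
      by congr (inner _ _ _); apply/funext => x; rewrite addr0.
    congr (2 * _ - _); rewrite inner_suml//; apply: eq_big_nat => k _.
    by rewrite (innerC _ (phi k)).
  have := HM A mA AO A0; rewrite -/m => HA.
  (* Young's inequality [2 a x <= a^2 m + x^2 / m] in each term, with [m] the measure of [A]; the
     first part cancels [c * m], the second is at most [M * m]. *)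
  have : 2 * \sum_(1 <= k < N.+1) a k * ip (\1_A) (phi k) <=
     c * m + (\sum_(1 <= k < N.+1) ip (\1_A) (phi k) ^+ 2) / m.
    rewrite mulr_sumr /c mulr_suml [X in _ + X]mulr_suml -big_split/=.
    apply: ler_sum => k _; rewrite -subr_ge0.
    have -> : a k ^+ 2 * m + ip (\1_A) (phi k) ^+ 2 / m - 2 * (a k * ip (\1_A) (phi k)) =
       (a k * m - ip (\1_A) (phi k)) ^+ 2 / m.
      by field; rewrite gt_eqF.
    by rewrite divr_ge0 ?sqr_ge0 ?ltW.
  have : (\sum_(1 <= k < N.+1) ip (\1_A) (phi k) ^+ 2) / m <= M * m.
    by rewrite ler_pdivrMr// -mulrA -expr2.
  lra.
have h0 : (\int[mu]_(x in Omega) `|(g x * \1_A x)%:E| = 0)%E.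
  have E x : `|(g x * \1_A x)%:E|%E = (g x * \1_A x)%:E.
    rewrite gee0_abs// lee_fin indicE; case: (boolP (x \in A)) => [|_]; last by rewrite mulr0.
    by rewrite inE => -[_ /ltW gx]; rewrite mulr1.
  under eq_integral do rewrite E.
  have ifin := integrable_fin_num mOmega (Lp2_mul_integrable mOmega Lg LA).
  rewrite -[LHS](fineK ifin); congr EFin; apply/eqP; rewrite eq_le; apply/andP; split => //.
  apply: fine_ge0; apply: integral_ge0 => x _; rewrite /= -E; exact: abse_ge0.
have mgA : measurable_fun Omega (fun x => (g x * \1_A x)%:E).
  by apply/measurable_EFinP/measurable_funM; exact: Lp2_measurable.
have /(ae_eq_integral_abs _ mOmega mgA) := h0.
move=> [Z [mZ Z0 subZ]].
have AZ : A `<=` Z.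
  move=> x Ax; apply: subZ => /= /(_ (AO _ Ax)) /eqP.
  rewrite indicE mem_set// mulr1 eqe; case: Ax => _ /= gx; by rewrite gt_eqF.
have : (mu A <= mu Z)%E by apply: le_measure; rewrite ?inE.
by rewrite Z0 leNgt A0.
Qed.

(** The best vector [a] is the value of the eigenfunctions at [x], which varies with [x]. Rational
    vectors keep the exceptional set null, and the error they cause is the sum of the squares of
    [phi k x - a k]. *)
Lemma ae_sum_sqr_le N M :
  (forall a : nat -> R, {ae mu, forall x, Omega x ->
    2 * \sum_(1 <= k < N.+1) a k * phi k x - \sum_(1 <= k < N.+1) a k ^+ 2 <= M}) ->
  {ae mu, forall x, Omega x -> \sum_(1 <= k < N.+1) phi k x ^+ 2 <= M}.
Proof.
move=> H.
(* Enumeration of all finite rational sequences, padded with zeros; codes of no sequence give the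
   zero vector. *)
pose q (i : nat) (k : nat) : R := ratr (nth 0 (odflt [::] (unpickle i : option (seq rat))) k).
have : \forall x \ae mu, forall i, Omega x ->
    2 * \sum_(1 <= k < N.+1) q i k * phi k x - \sum_(1 <= k < N.+1) q i k ^+ 2 <= M.
  by apply: ae_foralln => i; exact: H.
apply: filterS => x Hx Ox; apply/ler_addgt0Pl => e e0.
have N1 : 0 < N.+1%:R :> R by rewrite ltr0n.
pose d := Num.sqrt (e / N.+1%:R).
have d0 : 0 < d by rewrite sqrtr_gt0 divr_gt0.
have rk k : exists r : rat, phi k x - d < ratr r < phi k x + d.
  have : phi k x - d < phi k x + d by lra.
  by move=> /rat_in_itvoo[r]; rewrite in_itv/=; exists r.
have [r rP] := choice rk.
(* The list has [N.+1] entries because position 0 is filled as well, so that entry [k] approximates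
   [phi k x] without a shift. *)
have := Hx (pickle (mkseq r N.+1)) Ox; set p := pickle _.
have qE k : (1 <= k < N.+1)%N -> q p k = ratr (r k).
  by move=> /andP[_ kN]; rewrite /q pickleK/= nth_mkseq.
have : \sum_(1 <= k < N.+1) (phi k x - q p k) ^+ 2 <= e.
  apply: (@le_trans _ _ (\sum_(1 <= k < N.+1) e / N.+1%:R)).
    rewrite big_nat [leRHS]big_nat; apply: ler_sum => k kN.
    rewrite qE// -[leRHS]sqr_sqrtr ?divr_ge0 ?(ltW e0)// -/d.
    rewrite -[leLHS]real_normK ?num_real// ler_pXn2r ?nnegrE ?(ltW d0)//.
    by have /andP[? ?] := rP k; rewrite ler_norml; lra.
  rewrite sumr_const_nat subn1/= -[leLHS]mulr_natr mulrAC ler_pdivrMr// ler_wpM2l ?(ltW e0)//.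
  by rewrite ler_nat.
have -> : \sum_(1 <= k < N.+1) (phi k x - q p k) ^+ 2 =
  \sum_(1 <= k < N.+1) phi k x ^+ 2 - 2 * \sum_(1 <= k < N.+1) q p k * phi k x
  + \sum_(1 <= k < N.+1) q p k ^+ 2.
  rewrite mulr_sumr -sumrB -big_split/=; apply: eq_bigr => k _; ring.
lra.
Qed.

(** Each normalized function contributes 1 to the integral of the sum of squares, whose total is
    therefore [N]. *)
Lemma basis_size_le N M V : 0 <= M -> mu Omega = V%:E ->
  (forall k, (1 <= k)%N -> ip (phi k) (phi k) = 1) ->
  {ae mu, forall x, Omega x -> \sum_(1 <= k < N.+1) phi k x ^+ 2 <= M} ->
  N%:R <= M * V.
Proof.
move=> M0 OV n1 H.
have L1 : Lp Omega 2%:E (fun=> 1 : R).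
  by apply: Lp2_bounded => // x; rewrite ler01 lexx.
have mphi k : measurable_fun Omega (fun x => phi k.+1 x ^+ 2).
  by apply: measurable_funX; apply: Lp2_measurable => //; exact: Lphi.
rewrite -lee_fin EFinM -OV -integral_cst//.
have -> : (N%:R%:E = \int[mu]_(x in Omega) (\sum_(1 <= k < N.+1) phi k x ^+ 2)%:E)%E.
  under eq_integral do rewrite big_add1 -sumEFin.
  rewrite ge0_integral_sum//=; last 2 first.
  - by move=> k; apply/measurable_EFinP; exact: mphi.
  - by move=> k x _ ; rewrite lee_fin sqr_ge0.
  under eq_bigr => k _.
    rewrite (_ : (\int[mu]_(x in Omega) _)%E = 1%:E); last first.
      rewrite -(n1 k.+1)// /inner fineK; last first.
        by apply: (integrable_fin_num mOmega); apply: Lp2_mul_integrable => //; exact: Lphi.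
      by apply: eq_integral => x _; rewrite expr2.
    over.
  by rewrite sumEFin sumr_const_nat subn0.
apply: ae_ge0_le_integral => //.
- by move=> x _; rewrite lee_fin sumr_ge0// => k _; rewrite sqr_ge0.
- apply/measurable_EFinP; under eq_fun do rewrite big_add1.
  by apply: measurable_sum => k; exact: mphi.
Qed.

End pointwise.
Theorem theorem5p1 (R : realType) (n : nat) (s V CS : R)
    (s01 : 0 < s < 1) (ns : 2 * s < n%:R) :
  exists2 c : R, 0 < c &
  forall (gamma : R) (Omega : set 'rV[R]_n)
    (G : 'rV[R]_n -> 'rV[R]_n -> \bar R)
    (lam : nat -> R) (phi : nat -> 'rV[R]_n -> R),
  0 < gamma <= 1 ->
  bounded_domain Omega ->
  lebesgue_row n Omega = V%:E ->
  green_setting Omega G lam phi ->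
  sobolev_constant Omega s lam phi CS ->
  green_bounds Omega s gamma G ->
  continuous_weighted Omega gamma (green_op Omega G) ->
  sub_markovian Omega lam phi ->
  forall k : nat, (1 <= k)%N -> c * k%:R `^ (2 * s / n%:R) <= lam k.
Proof.
have /andP[s0 _] := s01.
have n0 : 0 < n%:R :> R by apply: lt_trans ns; rewrite mulr_gt0.
set nu := 2 * s / n%:R.
have nu0 : 0 < nu by rewrite divr_gt0 ?mulr_gt0.
(* The constant is fixed before [Omega], when [V] and [CS] are arbitrary reals; the maximum with 1
   makes [K] positive in every case. *)
pose K := Num.max 1 (expR 2 * (CS ^- 2 * 2 `^ nu^-1) `^ nu^-1 * V).
have K0 : 0 < K by rewrite lt_max ltr01.
exists (K `^ (- nu)); first exact: powR_gt0.
move=> gamma Omega G lam phi _ [_ oOmega _ _] OV gs sob _ _ markov N N1.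
have mOmega := measurable_row_open oOmega.
have fOmega : (lebesgue_row n Omega < +oo)%E by rewrite OV ltry.
have [_ _ _ _ [[Lphi onphi _] _ l12 lS _]] := gs.
have lamN := eigen_gt0 l12 lS N1.
set M := expR 2 * ((CS ^- 2 * 2 `^ nu^-1) `^ nu^-1 * lam N `^ nu^-1).
have M0 : 0 <= M by rewrite !mulr_ge0 ?expR_ge0 ?powR_ge0.
have NM : N%:R <= M * V.
  apply: (basis_size_le mOmega fOmega Lphi M0 OV) => [k k1|].
    by rewrite onphi// eqxx.
  apply: ae_sum_sqr_le => a; apply: (ae_lincomb_le mOmega fOmega Lphi) => // A mA AO A0.
  exact: (indicator_coefficients mOmega fOmega s01 ns gs sob markov).
have NK : N%:R <= K * lam N `^ nu^-1.
  apply: (le_trans NM); apply: (@le_trans _ _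
      (expR 2 * (CS ^- 2 * 2 `^ nu^-1) `^ nu^-1 * V * lam N `^ nu^-1)).
    by rewrite /M mulrA mulrAC.
  by rewrite ler_wpM2r ?powR_ge0// le_max lexx orbT.
(* What remains is the power [nu] of the inequality [NK]. *)
rewrite powRN mulrC ler_pdivrMr ?powR_gt0//.
have -> : lam N * K `^ nu = (K * lam N `^ nu^-1) `^ nu.
  rewrite powRM ?powR_ge0 ?(ltW K0)// -powRrM mulVf ?gt_eqF//.
  by rewrite powRr1 ?(ltW lamN)// mulrC.
apply: (ge0_ler_powR (ltW nu0)); rewrite ?nnegrE ?ler0n//.
by rewrite mulr_ge0 ?powR_ge0 ?(ltW K0).
Qed.
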